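(* Let $\Gamma\in\mathcal{G}$ and write $\Gamma\cong L\oplus H$, where $|H|$ is odd and $|L|$ is a power of $2$. Suppose that there exist prime numbers $p$ and $q$ such that $pq$ divides $|H|$, or that $\exp(\Gamma)<|\Gamma|/2$. Then there exist a positive integer $m<|\Gamma|$, a complete mapping $\varphi$ of $\Gamma$ and a partition $S_1,S_2,\ldots,S_t$ of the elements of $\Gamma$ such that $|S_i|=m$ and $\sum_{s\in S_i}s=\sum_{s\in S_i}\varphi(s)=0$ for every $1\leq i\leq t$.
   Context: Groups are finite Abelian, written additively. $\exp(\Gamma)$ is the least common multiple of the orders of all elements of $\Gamma$. An involution is an element of order $2$. $\mathcal{G}$ denotes the class of all finite Abelian groups that are of odd order or contain more than one involution. A complete mapping of $\Gamma$ is a bijection $\varphi\colon\Gamma\to\Gamma$ such that the mapping $g\mapsto g+\varphi(g)$ is also a bijection of $\Gamma$. The primes $p,q$ are not required to be distinct. *)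

(* Defs.v *)
From mathcomp Require Import all_boot all_order all_algebra.
From mathcomp Require Import all_fingroup all_solvable.

Set Implicit Arguments.
Unset Strict Implicit.
Unset Printing Implicit Defensive.

Import GRing.Theory.
Local Open Scope ring_scope.

(* Finite Abelian groups written additively are finZmodType's; [#[x]%g] and   *)
(* [exponent] below refer to the additive group, viewed as a finGroupType.    *)

Definition involutions (G : finZmodType) : {set G} :=
  [set x : G | #[x]%g == 2%N].

Definition in_classG (G : finZmodType) : Prop :=
  odd #|G| \/ (1 < #|involutions G|)%N.

Definition complete_mapping (G : finZmodType) (phi : G -> G) : Prop :=
  bijective phi /\ bijective (fun g => g + phi g).

(* Main.v *)
From HB Require Import structures.
Require Import Defs.
From mathcomp Require Import all_boot all_order all_algebra.
From mathcomp Require Import all_fingroup all_solvable.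

Set Implicit Arguments.
Unset Strict Implicit.
Unset Printing Implicit Defensive.

Import GRing.Theory.
Local Open Scope ring_scope.

(** The theorem comes from one construction and one classical fact.

    Classical fact (Hall's strengthening of a theorem of Paige): a finite
    abelian group whose elements sum to 0 has a complete mapping
    ([complete_mapping_of_sum0]).  A group of odd order, or with at least two
    involutions, has element sum 0 ([sum_classG]).

    Construction ([zero_sum_array_extension]).  Let B be a proper nontrivial
    subgroup of G, with quotient A = G / B whose elements sum to 0.  Choose
    representatives t a of the cosets with sum 0, so that every element of G is
    uniquely t a + b.  If psi is a complete mapping of A and theta an additive
    complete mapping of B, then t a + b |-> t (psi a) + theta b is a complete
    mapping of G.  Choose integer multipliers lam a, each acting bijectively on
    B, whose sum over A is 0.  The blocks { t a + lam a * b : a in A }, one for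
    each b in B, partition G and have size |A|; their elements sum to
    (sum of the t a) + (sum of the lam a) * b = 0, and since theta commutes with
    integer multiples, so do the images.  The multipliers 1 and -1 suffice when
    |A| is even; when |A| is odd, 1, 1, -2 supply the odd part, and |B| has to
    be odd for 2 to be invertible.

    It remains to find B.
    - If L and H are both nontrivial, take B = H, A = L, theta = id.
    - If L = 0, the hypotheses say that |H| is neither 1 nor prime; take B of
      prime order and theta = id.
    - If H = 0, take for B a Klein four-group <u, v>; it has an additive
      complete mapping of order 3.  This works unless the elements of G / B have
      nonzero sum, which for a 2-group forces G / B to be cyclic.  As exp(G) is
      at most |G| / 4, the extension then splits as G = <x> + B.  If x has
      order at least 4, the Klein four-group generated by u and the involution
      of <x> works instead.  If x has order 2, then G is elementary abelian of
      order 8: a linear complete mapping of order 7 (multiplication by a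
      generator of the field of order 8) sends the two cosets of a plane to the
      two cosets of another plane, and each of these four sets has sum 0. *)

(** * Permutations with prescribed differences *)

(** Multiplying by the transposition (x y) splits a cycle through both x and y
    into two cycles that separate them. *)
Lemma porbit_separate (T : finType) (s : {perm T}) (x y : T) : x != y ->
  exists2 t : {perm T}, (t == 1%g) || (t == tperm x y) &
    x \notin porbit (t * s)%g y.
Proof.
move=> neq_xy; have [xOy|] := boolP (x \in porbit s y); last first.
  by exists 1%g; rewrite ?eqxx // mul1g.
exists (tperm x y); first by rewrite eqxx orbT.
have := porbits_mul_tperm s x y; rewrite /= xOy /= addn0 neq_xy => card_ts.
have := porbits_mul_tperm (tperm x y * s)%g x y.
rewrite /= mulgA tperm2 mul1g neq_xy card_ts; case: (x \notin _) => // /eqP.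
by rewrite addn0 -[X in X == _]addn0 -addnA eqn_add2l.
Qed.

Lemma perm_on_porbit (T : finType) (s : {perm T}) (y : T) :
  {r : {perm T} | forall z, r z = if z \in porbit s y then s z else z}.
Proof.
have sO z : (s z \in porbit s y) = (z \in porbit s y).
  by rewrite -!eq_porbit_mem -(porbit_perm s 1 z) expg1.
have inj_r : injective (fun z => if z \in porbit s y then s z else z).
  move=> z1 z2; case: ifP => Oz1; case: ifP => Oz2 //; first exact: perm_inj.
    by move=> eq_z; rewrite -eq_z sO Oz1 in Oz2.
  by move=> eq_z; rewrite eq_z sO Oz2 in Oz1.
by exists (perm inj_r) => z; rewrite permE.
Qed.

(** The elementary move of Hall's theorem: two permutations a and c can be
    replaced so that the differences c k - a k change at p and q only, by d and
    - d.  Let a = id, Y = c p + q + d and e k = Y - c k.  If a is changed to e on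
    a set O that contains q but not p and is mapped onto itself by e, the
    prescribed differences force the new c to take the value
    Y - k = c (e^-1 k) at each k in O other than q, the value Y - q at p, and
    the value c p at q: these are the old values on O and p, permuted.  The
    e-orbit of q serves as O; if it contains p, the transposition t first
    separates p from q. *)
Lemma hall_step (G : finZmodType) (a c : {perm G}) (p q : G) (d : G) : p != q ->
  exists a' c' : {perm G}, forall k,
    c' k - a' k = c k - a k + (if k == p then d else 0)
                            - (if k == q then d else 0).
Proof.
wlog -> : a c p q / a = 1%g.
  move=> wlog_a neq_pq.
  have [//||a' [c' ac'E]] := wlog_a 1%g (a^-1 * c)%g (a p) (a q).
    by rewrite (inj_eq perm_inj).
  exists (a * a')%g, (a * c')%g => k.
  by rewrite !permM ac'E !(inj_eq perm_inj) !permM perm1 permK.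
move=> neq_pq; pose Y := c p + q + d.
have e_inj : injective (fun k => Y - c k) by move=> i j /addrI/oppr_inj/perm_inj.
pose e : {perm G} := perm e_inj.
have [t t_def pO] := porbit_separate e neq_pq.
have [r rE] := perm_on_porbit (t * e)%g q.
exists r, (tperm p q * r^-1 * t * c)%g => k; rewrite perm1.
have tt z : t (t z) = z by case/orP: t_def => /eqP->; rewrite ?perm1 ?tpermK.
have tN z : z != p -> z != q -> t z = z.
  by case/orP: t_def => /eqP->; rewrite ?perm1 // => zp zq; rewrite tpermD // eq_sym.
have tpq : c (t p) + c (t q) = c p + c q.
  by case/orP: t_def => /eqP->; rewrite ?perm1 // tpermL tpermR addrC.
have rp : r p = p by rewrite rE (negPf pO).
have rO z : z \in porbit (t * e)%g q -> r z = Y - c (t z).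
  by move=> zO; rewrite rE zO permM permE.
have rVO z : z \in porbit (t * e)%g q -> c (t (r^-1%g z)) = Y - z.
  move=> zO; have {2}-> : z = r (r^-1%g z) by rewrite permKV.
  rewrite rO; first by rewrite opprB addrC subrK.
  have := permKV r z; rewrite rE; case: ifP => // + eq_z.
  by rewrite eq_z zO.
rewrite !permM; case: (eqVneq k p) => [->|neq_kp].
  rewrite (negPf neq_pq) tpermL rVO ?porbit_id // rp subr0 /Y.
  by rewrite (addrAC _ d) addrK addrAC.
case: (eqVneq k q) => [->|neq_kq].
  rewrite tpermR -{1}rp permK rO ?porbit_id //.
  by rewrite opprB addrA tpq addr0 /Y !opprD !addrA [c p + c q]addrC addrK.
rewrite tpermD 1?eq_sym // addr0 subr0.
have [kO|kNO] := boolP (k \in porbit (t * e)%g q).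
  by rewrite rVO // rO // (tN k) // opprB addrC addrA subrK.
have rk : r k = k by rewrite rE (negPf kNO).
by rewrite -{1}rk permK rk (tN k).
Qed.

(** Starting from equal permutations, the differences at the nonzero elements
    are corrected one at a time, with the error collected at 0; there the
    difference is right in the end because both families have sum 0. *)
Theorem hall_differences (G : finZmodType) (b : G -> G) : \sum_g b g = 0 ->
  exists a c : {perm G}, forall k, c k - a k = b k.
Proof.
move=> sum_b.
have sum_ac (a c : {perm G}) : \sum_k (c k - a k) = 0.
  have sum_perm (s : {perm G}) : \sum_k s k = \sum_k k.
    by rewrite [RHS](reindex_inj (@perm_inj _ s)).
  by rewrite sumrB !sum_perm subrr.
suff [a [c acE]] : exists a c : {perm G}, forall k, k != 0 -> c k - a k = b k.
  exists a, c => k; case: (eqVneq k 0) => [->|]; last exact: acE.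
  rewrite (bigD1 0) //= in sum_b.
  have := sum_ac a c; rewrite (bigD1 0) //= (eq_bigr b) => [|i /acE //].
  by rewrite -[RHS]sum_b => /addIr.
suff [a [c acE]] : exists a c : {perm G},
    forall k, k \in enum (predC1 (0 : G)) -> c k - a k = b k.
  by exists a, c => k k0; apply: acE; rewrite mem_enum.
have : all (predC1 0) (enum (predC1 (0 : G))).
  by apply/allP => k; rewrite mem_enum.
elim: (enum _) => [|p s IHs] /=; first by exists 1%g, 1%g.
case/andP => p0 /[dup] /allP s0 /IHs[a [c acE]].
have [a' [c' ac'E]] := hall_step a c (b p - (c p - a p)) p0.
exists a', c' => k; rewrite inE ac'E; have [->|kp /= ks] := eqVneq k p.
  by rewrite (negPf p0) subr0 subrKC.
by rewrite (negPf (s0 k ks)) subr0 addr0 acE.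
Qed.

Corollary complete_mapping_of_sum0 (G : finZmodType) : \sum_(g : G) g = 0 ->
  exists phi : G -> G, complete_mapping phi.
Proof.
case/(@hall_differences G id) => a [c acE]; exists a; split.
  exact: injF_bij perm_inj.
have gE g : g + a g = c g by apply/esym/eqP; rewrite -subr_eq; apply/eqP/acE.
by apply: injF_bij => g1 g2; rewrite !gE => /perm_inj.
Qed.

(** * The sum of all elements *)

Lemma mulr2n_odd_eq0 (G : zmodType) (x : G) (n : nat) :
  x *+ 2 = 0 -> odd n -> x *+ n = x.
Proof.
move=> x2 n_odd; rewrite -(odd_double_half n) n_odd -muln2 mulnC mulrnDr.
by rewrite mulrnA x2 mul0rn addr0.
Qed.

Lemma finZmod_mulrn_card (G : finZmodType) (x : G) : x *+ #|G| = 0.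
Proof. by rewrite -cardsT; apply: (@expg_cardG G [set: G]%G); rewrite inE. Qed.

(** Both cancellations below pair off the elements of a set: x with - x, then
    x with x + w for an involution w. *)
Lemma sum_paired (T : finType) (G : zmodType) (P : pred T) (tau : T -> T)
    (F : T -> G) (c : G) :
    involutive tau -> (forall x, P x -> P (tau x)) ->
    (forall x, P x -> tau x != x) -> (forall x, P x -> F x + F (tau x) = c) ->
  exists2 n, #|P| = n.*2 & \sum_(x | P x) F x = c *+ n.
Proof.
move=> tauK Ptau tau_neq FE.
(* One representative of each pair {x, tau x}. *)
pose Q := [pred x | P x & (enum_rank x < enum_rank (tau x))%N].
have PQ (M : nmodType) (f : T -> M) :
    \sum_(x | P x) f x = \sum_(x | Q x) (f x + f (tau x)).
  rewrite big_split /= (bigID Q) /=; congr (_ + _).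
    by apply: eq_bigl => x; rewrite /= andbA andbb.
  rewrite [RHS](reindex_inj (inv_inj tauK)) /=.
  apply: eq_big => [x|x _]; rewrite tauK //.
  have -> : P (tau x) = P x by apply/idP/idP => /Ptau; rewrite ?tauK.
  case Px: (P x) => //=; rewrite -leqNgt leq_eqVlt.
  by rewrite (inj_eq val_inj) (inj_eq enum_rank_inj) (negPf (tau_neq x Px)).
exists #|Q|; last first.
  by rewrite PQ -sumr_const; apply: eq_bigr => x /andP[/FE].
by rewrite -sum1_card (PQ nat) -muln2 -sum_nat_const.
Qed.

Lemma involutionsE (G : finZmodType) (w : G) :
  (w \in involutions G) = (w != 0) && (w + w == 0).
Proof.
rewrite inE; apply/eqP/andP => [w2|[w0 /eqP ww]].
  split; last by rewrite -mulr2n -FinRing.zmodXgE -w2 expg_order.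
  by apply: contra_eq_neq w2 => ->; rewrite -FinRing.zmod1gE order1.
by apply: nt_prime_order => //; rewrite FinRing.zmodXgE mulr2n.
Qed.

(** The pairs {x, - x} reduce the sum to E, the elements with 2 x = 0.  Pairing
    x with x + w in E gives (|E| / 2) w for every involution w; two different
    involutions can give the same value only if |E| / 2 is even, and then the
    value is 0. *)
Lemma sum_classG (G : finZmodType) : in_classG G -> \sum_(g : G) g = 0.
Proof.
move=> G_class; set sigma := \sum_g g.
have sigma2 : sigma *+ 2 = 0.
  by rewrite mulr2n {2}/sigma (reindex_inj oppr_inj) /= sumrN subrr.
case: G_class => [G_odd|/card_gt1P[u [v [uI vI neq_uv]]]].
  by rewrite -(mulr2n_odd_eq0 sigma2 G_odd) finZmod_mulrn_card.
pose E := [pred x : G | x + x == 0].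
have sigmaE : sigma = \sum_(x | E x) x.
  rewrite /sigma (bigID E) /= -[RHS]addr0; congr (_ + _).
  have [||||n _ ->] := @sum_paired G G (predC E) -%R id 0; last exact: mul0rn.
  - exact: opprK.
  - by move=> x; rewrite /= -opprD oppr_eq0.
  - by move=> x; apply: contraNneq => xN; rewrite /= -{1}xN addNr.
  - by move=> x _; rewrite subrr.
have half_sum w : w != 0 -> w + w = 0 ->
    exists2 n, #|E| = n.*2 & sigma = w *+ n.
  move=> w0 ww; rewrite sigmaE; apply: (@sum_paired _ _ _ (+%R w)).
  - by move=> x; rewrite addrA ww add0r.
  - by move=> x /eqP xx; rewrite inE addrACA ww xx addr0.
  - by move=> x _; rewrite -subr_eq0 addrK.
  - by move=> x /eqP xx; rewrite addrCA xx addr0.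
move: uI vI; rewrite !involutionsE => /andP[u0 /eqP uu] /andP[v0 /eqP vv].
have [[n cardE sigma_u] [m cardE' sigma_v]] := (half_sum u u0 uu, half_sum v v0 vv).
have nm : n = m by apply: double_inj; rewrite -cardE.
have [n_odd|n_even] := boolP (odd n); last first.
  rewrite sigma_u -(odd_double_half n) (negPf n_even) -mul2n mulrnA.
  by rewrite mulr2n uu mul0rn.
case/eqP: neq_uv; rewrite -[u](@mulr2n_odd_eq0 _ _ n) ?mulr2n //.
by rewrite -sigma_u sigma_v -nm mulr2n_odd_eq0 // mulr2n.
Qed.

(** * Zero-sum blocks in an extension *)

(** The conclusion in coordinates: the blocks are the images under h of the
    sets I x {k}.  They automatically form a partition into sets of equal size,
    and the size is smaller than |G| as there are at least two blocks. *)
Definition zero_sum_array (G : finZmodType) : Prop :=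
  exists (I K : finType) (h : I * K -> G) (phi : G -> G),
    [/\ bijective h, complete_mapping phi, (1 < #|K|)%N
      & forall k, \sum_i h (i, k) = 0 /\ \sum_i phi (h (i, k)) = 0].

Lemma zero_sum_array_partition (G : finZmodType) : zero_sum_array G ->
  exists (m : nat) (phi : G -> G) (P : {set {set G}}),
    [/\ (0 < m < #|G|)%N,
        complete_mapping phi,
        partition P [set: G]
      & forall S : {set G}, S \in P ->
          [/\ #|S| = m, \sum_(s in S) s = 0 & \sum_(s in S) phi s = 0]].
Proof.
case=> I [K [h [phi [[hV hK hVK] phi_complete K_gt1 sum0]]]].
have cardG : #|G| = (#|I| * #|K|)%N.
  by rewrite -card_prod (bij_eq_card (Bijective hVK hK)).
have h_inj k : injective (fun i => h (i, k)).
  by move=> i j /(can_inj hK) [].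
exists #|I|, phi, (preim_partition (fun g => (hV g).2) [set: G]); split=> //.
- have : (0 < #|G|)%N by apply/card_gt0P; exists 0.
  by rewrite cardG muln_gt0 => /andP[I_gt0 _]; rewrite I_gt0 ltn_Pmulr.
- exact: preim_partitionP.
move=> _ /imsetP[g _ ->]; set k := (hV g).2.
have -> : [set y in [set: G] | k == (hV y).2] = [set h (i, k) | i : I].
  apply/setP=> y; rewrite !inE /=; apply/eqP/imsetP => [->|[i _ ->]].
    by exists (hV y).1 => //; rewrite -surjective_pairing hVK.
  by rewrite hK.
have sumS (F : G -> G) :
    \sum_(s in [set h (i, k) | i : I]) F s = \sum_i F (h (i, k)).
  by rewrite big_imset //= => i j _ _; apply: h_inj.
by rewrite card_imset //; split=> //; rewrite sumS; case: (sum0 k).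
Qed.

(** Alternating signs serve an even number of multipliers.  An odd number of
    signs cannot have sum 0; then 1, 1, -2 make up the odd part, as doubling is
    bijective on B. *)
Lemma sum0_multipliers (A B : finZmodType) : (1 < #|A|)%N ->
    (odd #|A| -> odd #|B|) ->
  exists2 lam : A -> int, \sum_a lam a = 0
    & forall a, injective (fun b : B => b *~ lam a).
Proof.
move=> A_gt1 AB; pose ok z := injective (fun b : B => b *~ z).
have ok1 : ok 1 by move=> b b'.
have okN1 : ok (-1) by move=> b b' /oppr_inj.
have [s [size_s sum_s ok_s]] : exists s : seq int,
    [/\ size s = #|A|, \sum_(z <- s) z = 0 & {in s, forall z, ok z}].
  have grow (s0 : seq int) n : \sum_(z <- s0) z = 0 -> {in s0, forall z, ok z} ->
      exists s : seq int,
      [/\ size s = (size s0 + n.*2)%N, \sum_(z <- s) z = 0 & {in s, forall z, ok z}].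
    move=> sum0 ok0; elim: n => [|n [s [size_s sum_s ok_s]]].
      by exists s0; rewrite addn0.
    exists [:: 1, -1 & s]; split=> /=; first by rewrite size_s doubleS !addnS.
      by rewrite !big_cons sum_s addr0 subrr.
    by move=> z; rewrite !inE => /or3P[/eqP->|/eqP->|/ok_s].
  have [A_odd|A_even] := boolP (odd #|A|); last first.
    have [||s] := grow [::] #|A|./2; [by rewrite big_nil | by [] |].
    by rewrite even_halfK // => s_ok; exists s.
  have okN2 : ok (-2).
    move=> b b' /eqP; rewrite -subr_eq0 -mulrzBl mulrNz oppr_eq0 => /eqP b2.
    apply/eqP; rewrite -subr_eq0 -(mulr2n_odd_eq0 b2 (AB A_odd)).
    by rewrite finZmod_mulrn_card.
  have [|z|s] := grow [:: 1; 1; -2] (#|A| - 3)./2.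
  - by rewrite !big_cons big_nil.
  - by rewrite !inE => /or3P[] /eqP->.
  have A_ge3 : (2 < #|A|)%N.
    by rewrite ltn_neqAle A_gt1 andbT; apply: contraTneq A_odd => <-.
  by rewrite even_halfK ?oddB ?A_odd // subnKC // => s_ok; exists s.
exists (fun a => s`_(enum_rank a)) => [|a]; last first.
  by apply/ok_s/mem_nth; rewrite size_s.
rewrite (reindex _ (onW_bij _ (@enum_val_bij A))) -[RHS]sum_s.
rewrite (big_nth 0) size_s big_mkord.
by apply: eq_bigr => i _; rewrite enum_valK.
Qed.

(** The construction for an exact sequence B -> G -> A.  The map theta has to be
    additive in order to commute with the multipliers. *)
Lemma zero_sum_array_extension (B A G : finZmodType) (iota : {additive B -> G})
    (pi : {additive G -> A}) (theta : {additive B -> B}) :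
    injective iota -> (forall a, exists g, pi g = a) ->
    (forall g, pi g = 0 <-> exists b, g = iota b) ->
    (1 < #|A|)%N -> (1 < #|B|)%N -> (odd #|A| -> odd #|B|) ->
    \sum_(a : A) a = 0 -> complete_mapping theta ->
  zero_sum_array G.
Proof.
move=> iota_inj pi_surj ker_pi A_gt1 B_gt1 AB sumA [theta_bij theta1_bij].
have pi_iota b : pi (iota b) = 0 by apply/ker_pi; exists b.
(* The sum of arbitrary representatives lies in the kernel of pi, as the
   elements of A have sum 0; subtract it from the representative of 0. *)
have [t tK sum_t] : exists2 t : A -> G, cancel t pi & \sum_a t a = 0.
  have [t0 t0K] := fin_all_exists pi_surj.
  have [|b0 sum_t0] := (ker_pi (\sum_a t0 a)).1.
    by rewrite raddf_sum -[RHS]sumA; apply: eq_bigr => a _; apply: t0K.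
  exists (fun a => t0 a - (if a == 0 then iota b0 else 0)) => [a|].
    by rewrite raddfB t0K; case: ifP; rewrite ?pi_iota ?(raddf0 pi) subr0.
  by rewrite sumrB -big_mkcond big_pred1_eq sum_t0 subrr.
have [lam sum_lam lam_inj] := sum0_multipliers A_gt1 AB.
have [psi [psi_bij psi1_bij]] := complete_mapping_of_sum0 sumA.
have pi_ti a b : pi (t a + iota b) = a by rewrite raddfD tK pi_iota addr0.
pose j (ab : A * B) := t ab.1 + iota ab.2.
have j_inj : injective j.
  move=> [a b] [a' b'] /[dup] /(congr1 pi); rewrite /j /= !pi_ti => <-.
  by move/addrI/iota_inj->.
have j_surj g : exists ab, j ab = g.
  have /ker_pi[b gE] : pi (g - t (pi g)) = 0 by rewrite raddfB tK subrr.
  by exists (pi g, b); rewrite /j /= -gE subrKC.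
have [k kK] := fin_all_exists j_surj.
have jK : cancel j k by move=> ab; apply: j_inj; rewrite kK.
pose phi g := j (psi (k g).1, theta (k g).2).
have phi_j a b : phi (j (a, b)) = t (psi a) + iota (theta b) by rewrite /phi jK.
exists A, B, (fun ab => j (ab.1, ab.2 *~ lam ab.1)), phi; split=> //.
- apply: inj_card_bij; last by rewrite -(bij_eq_card (Bijective jK kK)).
  by move=> [a b] [a' b'] /j_inj[/= <- /lam_inj->].
- split; apply: injF_bij => g g'; rewrite -(kK g) -(kK g').
    rewrite !phi_j -/(j (_, _)) -/(j (_, _)).
    case: (k g) (k g') => [a b] [a' b'] /j_inj[].
    by move/(bij_inj psi_bij)-> => /(bij_inj theta_bij)->.
  case: (k g) (k g') => [a b] [a' b']; rewrite !phi_j /j /= => eq_g.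
  have := congr1 pi eq_g; rewrite !(raddfD pi) !tK !pi_iota !addr0.
  move/(bij_inj psi1_bij) => eq_a; move: eq_g; rewrite -eq_a.
  rewrite addrACA [RHS]addrACA => /addrI.
  by rewrite -!raddfD => /iota_inj/(bij_inj theta1_bij)->.
move=> b; split.
  rewrite big_split /= sum_t add0r -raddf_sum -mulrz_sumr.
  by rewrite sum_lam mulr0z raddf0.
under eq_bigr do rewrite phi_j.
have sum_tpsi : \sum_a t (psi a) = 0.
  by rewrite -[RHS]sum_t [RHS](reindex _ (onW_bij _ psi_bij)).
rewrite big_split /= sum_tpsi add0r -(raddf_sum iota) -(raddf_sum theta) -mulrz_sumr.
by rewrite sum_lam mulr0z !raddf0.
Qed.

(** * Quotients of finite abelian groups *)

Lemma additive_of_morph (U V : zmodType) (f : U -> V) :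
  {morph f : x y / x + y} -> exists g : {additive U -> V}, g =1 f.
Proof.
move=> fD; have f0 : f 0 = 0 by apply: (addIr (f 0)); rewrite -fD !add0r.
pose fM := GRing.isNmodMorphism.Build U V f (f0, fD).
by exists (HB.pack f fM : {additive U -> V}).
Qed.

Section QuotientGroup.

Variables (G : finZmodType) (H : {group G}).

(** A separate name for the type of cosets, so that the additive structure does
    not attach to quotients of arbitrary finite groups. *)
Definition zmod_quotient := coset_of H.

HB.instance Definition _ := Finite.on zmod_quotient.

Lemma zmod_coset_repr (g : G) : g \in 'N(H)%g.
Proof.
rewrite -sub1set cents_norm //; apply/centsP => x _ y _.
exact: FinRing.zmod_mulgC.
Qed.

Lemma zmod_coset_mulC : commutative (fun x y : zmod_quotient => (x * y)%g).
Proof.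
move=> x y; case: (cosetP x) => g Ng ->; case: (cosetP y) => h Nh ->.
by rewrite -!morphM // FinRing.zmod_mulgC.
Qed.

HB.instance Definition _ := GRing.isZmodule.Build zmod_quotient
  (fun x y z => mulgA x y z) zmod_coset_mulC (fun x => mul1g x) (fun x => mulVg x).

End QuotientGroup.

Lemma quotient_by_image (B G : finZmodType) (iota : {additive B -> G}) :
    injective iota ->
  exists (A : finZmodType) (pi : {additive G -> A}),
    [/\ forall a, exists g, pi g = a,
        forall g, pi g = 0 <-> exists b, g = iota b
      & (#|A| * #|B|)%N = #|G|].
Proof.
move=> iota_inj.
have gH : group_set [set iota b | b : B].
  apply/group_setP; split; first by apply/imsetP; exists 0; rewrite ?raddf0.
  move=> _ _ /imsetP[b _ ->] /imsetP[b' _ ->].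
  by apply/imsetP; exists (b + b'); rewrite ?raddfD.
pose H := Group gH; have nH g := @zmod_coset_repr G H g.
have [pi piE] : exists pi : {additive G -> zmod_quotient H}, pi =1 coset H.
  by apply: additive_of_morph => x y; apply: morphM.
exists (zmod_quotient H), pi; split=> [a|g|].
- by case: (cosetP a) => g _ ->; exists g.
- rewrite piE; split=> [g1|[b ->]].
    by have /imsetP[b _ ->] := coset_idr (nH g) g1; exists b.
  by apply: coset_id; apply: imset_f.
have -> : #|B| = #|H| by rewrite card_imset.
rewrite -[#|G|]cardsT -(Lagrange (subsetT H)) mulnC; congr (_ * _)%N.
rewrite -card_quotient; last by apply/subsetP.
rewrite -cardsT; apply: eq_card => a; rewrite !inE; apply/esym.
by case: (cosetP a) => g Ng ->; rewrite mem_quotient // inE.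
Qed.

(** * Klein four-groups *)

Lemma Zp_embedding (G : zmodType) (x : G) (n : nat) : (1 < n)%N -> x *+ n = 0 ->
  exists f : {additive 'Z_n -> G}, forall k, f k = x *+ k.
Proof.
move=> n_gt1 xn; apply: (@additive_of_morph _ _ (fun k : 'Z_n => x *+ k)) => a b.
rewrite -mulrnDr /= {3}(Zp_cast n_gt1) {2}(divn_eq (a + b) n) mulrnDr mulnC.
by rewrite mulrnA xn mul0rn add0r.
Qed.

(** A separate name for the product, to carry the finite additive group
    structure. *)
Definition klein := ('Z_2 * 'Z_2)%type.

HB.instance Definition _ := Finite.on klein.
HB.instance Definition _ := GRing.Zmodule.on klein.

Lemma Z2_cases (k : 'Z_2) : k = 0 \/ k = 1.
Proof. by case: k => [[|[|//]] lt_k]; [left|right]; apply: val_inj. Qed.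

Lemma klein_embedding (G : zmodType) (u v : G) : u + u = 0 -> v + v = 0 ->
    u != 0 -> v != 0 -> u != v ->
  exists2 f : {additive klein -> G}, injective f
    & forall g, g \in [:: 0; u; v; u + v] <-> exists b, g = f b.
Proof.
move=> uu vv u0 v0 neq_uv.
have [//||fu fuE] := @Zp_embedding G u 2; first by rewrite mulr2n.
have [//||fv fvE] := @Zp_embedding G v 2; first by rewrite mulr2n.
have [ab cd|f fE] := @additive_of_morph klein G (fun ab => fu ab.1 + fv ab.2).
  by rewrite /= !raddfD addrACA.
exists f => [|g].
  apply: raddf_inj => -[a b]; rewrite fE /= fuE fvE.
  case: (Z2_cases a) (Z2_cases b) => -> [] -> //=; rewrite ?addr0 ?add0r => /eqP.
  - by rewrite (negPf v0).
  - by rewrite (negPf u0).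
  - by rewrite -[v]opprK subr_eq0 -[- v]addr0 -vv addKr (negPf neq_uv).
split; last first.
  case=> -[a b] ->; rewrite fE /= fuE fvE.
  by case: (Z2_cases a) (Z2_cases b) => -> [] ->;
    rewrite /= ?addr0 ?add0r !inE eqxx ?orbT.
rewrite !inE => /or4P[] /eqP->; [exists (0, 0)|exists (1, 0)|exists (0, 1)|exists (1, 1)];
  by rewrite fE /= fuE fvE /= ?addr0 ?add0r.
Qed.

(** Multiplication by a generator of the multiplicative group of the field of
    order 4. *)
Lemma klein_complete_mapping :
  exists theta : {additive klein -> klein},
    complete_mapping theta.
Proof.
have [a b|theta thetaE] := @additive_of_morph _ _
    (fun ab : klein => (ab.2, ab.1 + ab.2) : klein).
  by congr (_, _); rewrite /= addrACA.
exists theta; split; apply: injF_bij => -[a b] [a' b']; rewrite !thetaE.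
  by move=> /[dup] /(congr1 fst) /= <- /(congr1 snd) /addIr /= ->.
move=> /[dup] /(congr1 fst) /= eq_s /(congr1 snd) /=; rewrite eq_s => /addIr eq_b.
by move: eq_s; rewrite eq_b => /addIr->.
Qed.

Lemma card_klein : #|{: klein}| = 4.
Proof. by rewrite card_prod !card_ord. Qed.

Lemma sum_klein (U : zmodType) (F : klein -> U) :
  \sum_i F i = F (0, 0) + F (0, 1) + (F (1, 0) + F (1, 1)).
Proof.
have sum_Z2 (E : 'Z_2 -> U) : \sum_i E i = E 0 + E 1.
  by rewrite !big_ord_recl big_ord0 addr0; congr (_ + E _); apply: val_inj.
rewrite (eq_bigr (fun i => F (i.1, i.2))) => [|[]//].
by rewrite -(pair_bigA _ (fun a b => F (a, b))) /= sum_Z2 !sum_Z2.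
Qed.

Lemma klein_quotient (G : finZmodType) (u v : G) :
    u \in involutions G -> v \in involutions G -> u != v ->
  exists (A : finZmodType) (pi : {additive G -> A}),
    [/\ forall a, exists g, pi g = a,
        forall g, pi g = 0 <-> g \in [:: 0; u; v; u + v],
        (#|A| * 4)%N = #|G|
      & (1 < #|A|)%N -> ~~ odd #|A| -> \sum_(a : A) a = 0 -> zero_sum_array G].
Proof.
rewrite !involutionsE => /andP[u0 /eqP uu] /andP[v0 /eqP vv] neq_uv.
have [iota iota_inj imE] := klein_embedding uu vv u0 v0 neq_uv.
have [A [pi [pi_surj ker_pi cardA]]] := @quotient_by_image klein G iota iota_inj.
have [theta theta_complete] := klein_complete_mapping.
exists A, pi; split=> //.
- by move=> g; split; [move/ker_pi/imE | move/imE/ker_pi].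
- by rewrite -cardA card_klein.
move=> A_gt1 A_even sumA.
apply: (@zero_sum_array_extension klein A G iota pi theta) => //.
  by rewrite card_klein.
by rewrite (negPf A_even).
Qed.

Lemma klein_subgroup_double (G : zmodType) (u v g : G) : u + u = 0 -> v + v = 0 ->
  g \in [:: 0; u; v; u + v] -> g + g = 0.
Proof.
move=> uu vv; rewrite !inE => /or4P[] /eqP-> //; first by rewrite addr0.
by rewrite addrACA uu vv addr0.
Qed.

(** * Abelian 2-groups *)

(** A noncyclic abelian 2-group contains an elementary abelian subgroup of order
    4, hence three involutions. *)
Lemma few_involutions_cyclic (A : finZmodType) (k : nat) : #|A| = (2 ^ k)%N ->
  (#|involutions A| <= 1)%N -> cyclic [set: A].
Proof.
move=> cardA; apply: contraTT => ncycA; rewrite -ltnNge.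
have /rank_geP[E /nElemP[p Ep2]] : (2 <= 'r([set: A])%g)%N.
  by rewrite ltnNge -abelian_rank1_cyclic ?FinRing.zmod_abelian.
have p_pr := pnElem_prime Ep2; have cardE := card_pnElem Ep2.
have [_ /(abelemP p_pr)[_ expE] _] := pnElemP Ep2.
have p2 : p = 2.
  have : (p %| 2 ^ k)%N.
    rewrite -cardA -cardsT (dvdn_trans _ (cardSg (subsetT E))) // cardE.
    by rewrite dvdn_exp.
  by rewrite Euclid_dvdX // dvdn_prime2 // => /andP[/eqP].
have card3 : #|E :\ 1%g| = 3.
  by have := cardsD1 1%g E; rewrite group1 cardE p2 => -[].
suff : (#|E :\ 1%g| <= #|involutions A|)%N by rewrite card3; apply: leq_trans.
apply/subset_leq_card/subsetP => w; rewrite !inE => /andP[w1 wE].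
rewrite p2 in expE.
by apply/eqP/nt_prime_order => //; apply: expE.
Qed.

(** The group of order 8 and exponent 2 needs its own argument: its quotient by a
    Klein four-group has order 2, hence nonzero element sum.  The map M is
    the companion matrix of X^3 + X + 1 over the field with two elements; this
    polynomial has no root there, so M and 1 + M are invertible. *)
Lemma zero_sum_array_Z2_cube (G : finZmodType) (u v x : G) : #|G| = 8 ->
    u \in involutions G -> v \in involutions G -> u != v ->
    x + x = 0 -> x \notin [:: 0; u; v; u + v] ->
  zero_sum_array G.
Proof.
rewrite !involutionsE => cardG /andP[u0 /eqP uu] /andP[v0 /eqP vv] neq_uv xx xNV.
have [iota iota_inj imE] := klein_embedding uu vv u0 v0 neq_uv.
have [//||fx fxE] := @Zp_embedding G x 2; first by rewrite mulr2n.
have [s t|f fE] := @additive_of_morph ('Z_2 * 'Z_2 * 'Z_2)%type G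
    (fun t => iota t.1 + fx t.2).
  by rewrite /= !raddfD addrACA.
have f_inj : injective f.
  apply: raddf_inj => -[b c]; rewrite fE fxE /=.
  case: (Z2_cases c) => ->; first by rewrite addr0 -(raddf0 iota) => /iota_inj->.
  move=> iota_x; case/negP: xNV; apply/imE; exists (- b).
  by apply/eqP; rewrite raddfN -subr_eq0 opprK addrC iota_x.
have f_bij : bijective f by apply: inj_card_bij; rewrite // cardG !card_prod !card_ord.
have [g fK gK] := f_bij.
pose M (t : 'Z_2 * 'Z_2 * 'Z_2) : 'Z_2 * 'Z_2 * 'Z_2 := (t.2, t.1.1 + t.2, t.1.2).
exists ('Z_2 * 'Z_2)%type, 'Z_2, f, (f \o M \o g); split=> //.
- have bijP (F : G -> G) : injective (F \o f) -> bijective F.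
    by move=> F_inj; apply: injF_bij => y z; rewrite -(gK y) -(gK z) => /F_inj->.
  split; apply: bijP => s t; rewrite /= !fK -?raddfD => /f_inj.
    case: s t => [[a b] c] [[a' b'] c'] eqM.
    have /= eq_c := congr1 (fun t => t.1.1) eqM.
    have /= := congr1 (fun t => t.1.2) eqM; rewrite eq_c => /addIr->.
    by have /= -> := congr1 snd eqM.
  case: s t => [[a b] c] [[a' b'] c'] eqM.
  have /= eq_ac := congr1 (fun t => t.1.1) eqM.
  have /= := congr1 (fun t => t.1.2) eqM; rewrite eq_ac => /addIr eq_b.
  have /= := congr1 (fun t => t.2) eqM; rewrite eq_b => /addIr eq_c.
  by move: eq_ac; rewrite eq_c => /addIr->.
- by rewrite card_ord.
move=> c; split; last under eq_bigr do rewrite /= fK.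
  rewrite (sum_klein (fun i => f (i, c))) -!raddfD; apply/eqP.
  by rewrite raddf_eq0 //; case: (Z2_cases c) => ->.
rewrite (sum_klein (fun i => f (M (i, c)))) -!raddfD; apply/eqP.
by rewrite raddf_eq0 //; case: (Z2_cases c) => ->.
Qed.

(** If the quotient A by <u, v> is cyclic, a preimage x of a generator has order
    exactly |A|, since exp(G) divides |G| / 4 = |A|; hence <x> meets <u, v>
    trivially.  With z the involution of <x>, the classes of v and of a half of
    z are two different involutions modulo <z, u>. *)
Lemma zero_sum_array_2group (G : finZmodType) (k : nat) : #|G| = (2 ^ k)%N ->
    (1 < #|involutions G|)%N -> (exponent [set: G] * 2 < #|G|)%N ->
  zero_sum_array G.
Proof.
move=> cardG /card_gt1P[u [v [uI vI neq_uv]]] small_exp.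
have [A [pi [pi_surj ker_pi cardA arrayG]]] := klein_quotient uI vI neq_uv.
move: (uI) (vI); rewrite !involutionsE => /andP[_ /eqP uu] /andP[_ /eqP vv].
have [j expE] : exists j, exponent [set: G] = (2 ^ j)%N.
  have /(dvdn_pfactor _ _ (erefl : prime 2))[j _ ->] :
      (exponent [set: G] %| 2 ^ k)%N.
    by rewrite -cardG -cardsT exponent_dvdn.
  by exists j.
have lt_jk : (j.+1 < k)%N.
  by move: small_exp; rewrite expE cardG -expnSr ltn_exp2l.
have j_gt0 : (0 < j)%N.
  rewrite lt0n; apply: contraTneq uI => j0; rewrite inE.
  by have := dvdn_exponent (in_setT u); rewrite expE j0 dvdn1 => /eqP->.
have [n kE] : exists n, k = n.+3.
  have k_gt2 : (2 < k)%N by apply: leq_trans lt_jk.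
  by exists (k - 3)%N; rewrite -addn3 subnK.
rewrite {k}kE in cardG lt_jk.
have {}cardA : #|A| = (2 ^ n.+1)%N.
  by apply/eqP; rewrite -(eqn_pmul2r (isT : 0 < 4)%N) cardA cardG 2!expnSr -mulnA.
have A_gt1 : (1 < #|A|)%N by rewrite cardA -{1}(expn0 2) ltn_exp2l.
have A_even : ~~ odd #|A| by rewrite cardA oddX.
have [sumA|/eqP sumA] := eqVneq (\sum_(a : A) a) 0; first exact: arrayG.
have /cyclicP[xbar Axbar] : cyclic [set: A].
  apply: (few_involutions_cyclic cardA); rewrite leqNgt.
  by apply/negP => A_inv; apply: sumA; apply: sum_classG; right.
have ord_xbar : #[xbar]%g = #|A| by rewrite -cardsT Axbar.
have [x pi_x] := pi_surj xbar.
have xA : x *+ #|A| = 0.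
  have /dvdnP[q ->] : (exponent [set: G] %| #|A|)%N.
    by rewrite expE cardA dvdn_exp2l.
  rewrite mulnC mulrnA -[x *+ _]FinRing.zmodXgE expg_exponent ?in_setT //.
  by rewrite FinRing.zmod1gE mul0rn.
(* <x> meets <u, v> trivially. *)
have xV m : x *+ m \in [:: 0; u; v; u + v] -> (#|A| %| m)%N.
  move/ker_pi; rewrite raddfMn pi_x => xbar_m.
  by rewrite -ord_xbar order_dvdn FinRing.zmodXgE xbar_m.
have [n0|n_gt0] := posnP n.
  apply: (@zero_sum_array_Z2_cube G u v x) => //; first by rewrite cardG n0.
    by rewrite -mulr2n -[RHS]xA cardA n0.
  by apply/negP; rewrite -[x]mulr1n => /xV; rewrite cardA n0.
have [l Al l_gt0] : exists2 l, #|A| = l.*2.*2 & (0 < l)%N.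
  exists (2 ^ n.-1)%N; last by rewrite expn_gt0.
  by rewrite cardA -!mul2n -!expnS prednK.
pose z := x *+ l.*2.
have zz : z + z = 0 by rewrite -mulrnDr addnn -Al.
have zNV : z \notin [:: 0; u; v; u + v].
  apply/negP => /xV /dvdn_leq; rewrite Al double_gt0 l_gt0 leq_double leqNgt.
  by rewrite -addnn -[X in (X < _)%N]addn0 ltn_add2l l_gt0 => /(_ isT).
move: (zNV); rewrite !inE !negb_or => /and4P[z0 zu zv zuv].
have zI : z \in involutions G by rewrite involutionsE z0 zz eqxx.
have [A' [pi' [_ ker_pi' cardA' arrayG']]] := klein_quotient zI uI zu.
have eqA' : #|A'| = #|A|.
  apply/eqP; rewrite -(eqn_pmul2r (isT : 0 < 4)%N) cardA' cardG cardA.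
  by rewrite 2!expnSr -mulnA.
apply: arrayG'; rewrite ?eqA' //; apply: sum_classG; right.
have double0 g : pi' g = 0 -> g + g = 0.
  by move/ker_pi'; apply: klein_subgroup_double.
apply/card_gt1P; exists (pi' v), (pi' (x *+ l)); split.
- rewrite involutionsE -raddfD vv raddf0 eqxx andbT.
  apply/eqP => /ker_pi'; rewrite !inE => /or4P[]; apply/negP.
  + by move: vI; rewrite involutionsE => /andP[].
  + by rewrite eq_sym.
  + by rewrite eq_sym.
  + apply: contra zuv => /eqP->; rewrite addrA [u + z]addrC -addrA uu.
    by rewrite addr0.
- rewrite involutionsE -raddfD -mulrnDr addnn; apply/andP; split.
    apply/eqP => /double0; rewrite -mulrnDr addnn; exact/eqP.
  by apply/eqP/ker_pi'; rewrite !inE eqxx orbT.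
apply/eqP => eq_pi; have /double0 : pi' (x *+ l - v) = 0.
  by rewrite raddfB eq_pi subrr.
rewrite addrACA -opprD vv subr0 -mulrnDr addnn; exact/eqP.
Qed.

(** * The case distinction *)

Lemma id_complete_mapping (B : finZmodType) :
  odd #|B| -> complete_mapping (@id B).
Proof.
move=> B_odd; split; apply: injF_bij => // b b' /eqP.
rewrite -subr_eq0 opprD addrACA -mulr2n => /eqP b2; apply/eqP.
by rewrite -subr_eq0 -(mulr2n_odd_eq0 b2 B_odd) finZmod_mulrn_card.
Qed.

Lemma zero_sum_array_odd (G : finZmodType) : odd #|G| -> (1 < #|G|)%N ->
  ~~ prime #|G| -> zero_sum_array G.
Proof.
move=> G_odd G_gt1 G_nprime; pose p := pdiv #|G|.
have p_pr : prime p by apply: pdiv_prime.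
have p_gt1 := prime_gt1 p_pr.
have cardZp : #|'Z_p| = p by rewrite card_ord Zp_cast.
have [x _ ord_x] : {x : G | x \in [set: G] & #[x]%g = p}.
  by apply: Cauchy; rewrite // cardsT pdiv_dvd.
have [//||iota iotaE] := @Zp_embedding G x p.
  by rewrite -FinRing.zmodXgE -ord_x expg_order.
have iota_inj : injective iota.
  apply: raddf_inj => k; rewrite iotaE -FinRing.zmodXgE => /eqP.
  rewrite -order_dvdn ord_x -{1}(Zp_cast p_gt1) => p_k.
  by apply: val_inj; rewrite /= -(modn_small (ltn_ord k)); apply/eqP.
have [A [pi [pi_surj ker_pi]]] := quotient_by_image iota_inj.
rewrite cardZp => cardA.
have A_odd : odd #|A| by move: G_odd; rewrite -cardA oddM => /andP[].
apply: (@zero_sum_array_extension _ A G iota pi idfun) => //.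
- rewrite ltn_neqAle eq_sym; apply/andP; split; last by apply/card_gt0P; exists 0.
  by apply: contra G_nprime => /eqP A1; rewrite -cardA A1 mul1n.
- by rewrite cardZp.
- by move=> _; move: G_odd; rewrite cardZp -cardA oddM => /andP[].
- by apply: sum_classG; left.
- apply: id_complete_mapping; rewrite cardZp.
  by move: G_odd; rewrite -cardA oddM => /andP[].
Qed.

Theorem corollary3p5 (Gam L H : finZmodType) (f : {additive Gam -> (L * H)%type})
    (Gam_G : in_classG Gam)
    (f_iso : bijective f)
    (H_odd : odd #|H|)
    (L_pow2 : exists k : nat, #|L| = (2 ^ k)%N)
    (hyp : (exists p q : nat, [/\ prime p, prime q & (p * q %| #|H|)%N])
           \/ (exponent [set: Gam])%:R < #|Gam|%:R / 2%:R :> rat) :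
  exists (m : nat) (phi : Gam -> Gam) (P : {set {set Gam}}),
    [/\ (0 < m < #|Gam|)%N,
        complete_mapping phi,
        partition P [set: Gam]
      & forall S : {set Gam}, S \in P ->
          [/\ #|S| = m, \sum_(s in S) s = 0 & \sum_(s in S) phi s = 0]].
Proof.
apply: zero_sum_array_partition.
have [k cardL] := L_pow2.
have cardGam : #|Gam| = (#|L| * #|H|)%N by rewrite -card_prod (bij_eq_card f_iso).
have {}hyp : (exists p q : nat, [/\ prime p, prime q & (p * q %| #|H|)%N])
    \/ (exponent [set: Gam] * 2 < #|Gam|)%N.
  case: hyp => [|small_exp]; [by left | right].
  by move: small_exp; rewrite Num.Theory.ltr_pdivlMr // -natrM Num.Theory.ltr_nat.
have [L1|L_gt1] := leqP #|L| 1.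
  have {}cardGam : #|Gam| = #|H|.
    rewrite cardGam (_ : #|L| = 1%N) ?mul1n //.
    by apply/eqP; rewrite eqn_leq L1; apply/card_gt0P; exists 0.
  have [H_gt1 H_nprime] : (1 < #|H|)%N /\ ~~ prime #|H|.
    have H_gt0 : (0 < #|H|)%N by apply/card_gt0P; exists 0.
    case: hyp => [[p [q [p_pr q_pr pqH]]]|small_exp].
      have pH : (p %| #|H|)%N := dvdn_trans (dvdn_mulr q (dvdnn p)) pqH.
      split; first exact: leq_trans (prime_gt1 p_pr) (dvdn_leq H_gt0 pH).
      apply/negP => H_pr; move: pqH.
      have -> : p = #|H| by apply/eqP; rewrite -dvdn_prime2.
      rewrite -[X in (_ %| X)%N]muln1 dvdn_pmul2l // dvdn1 => /eqP q1.
      by rewrite q1 in q_pr.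
    rewrite cardGam in small_exp; split.
      by apply: leq_trans small_exp; rewrite ltnS muln_gt0 exponent_gt0.
    apply/negP => H_pr.
    have [x _ ord_x] : {x : Gam | x \in [set: Gam] & #[x]%g = #|H|}.
      by apply: Cauchy; rewrite // cardsT cardGam.
    have := dvdn_leq (exponent_gt0 _) (dvdn_exponent (in_setT x)).
    rewrite ord_x leqNgt (leq_ltn_trans _ small_exp) //.
    by rewrite leq_pmulr.
  by apply: zero_sum_array_odd; rewrite cardGam.
have k_gt0 : (0 < k)%N by move: L_gt1; rewrite cardL; case: k {cardL}.
have L_even : ~~ odd #|L| by rewrite cardL oddX -[k == 0]negbK -lt0n k_gt0.
have [H1|H_gt1] := leqP #|H| 1.
  have {}H1 : #|H| = 1%N.
    by apply/eqP; rewrite eqn_leq H1; apply/card_gt0P; exists 0.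
  case: hyp => [[p [q [p_pr _]]]|small_exp].
    by rewrite H1 dvdn1 muln_eq1 => /andP[/eqP p1]; rewrite p1 in p_pr.
  rewrite H1 muln1 in cardGam.
  case: Gam_G => [|two_inv]; first by rewrite cardGam (negPf L_even).
  by apply: (@zero_sum_array_2group _ k) => //; rewrite cardGam.
have [g fK gK] := f_iso.
have [g0 gD] : nmod_morphism g by apply: can2_nmod_morphism fK gK.
have [h h'|iota iotaE] := @additive_of_morph H Gam (fun h => g (0, h)).
  by rewrite -gD; congr g; congr (_, _); rewrite addr0.
have [x y|pi piE] := @additive_of_morph Gam L (fun x => (f x).1).
  by rewrite raddfD.
apply: (@zero_sum_array_extension H L Gam iota pi idfun) => //.
- by move=> h h'; rewrite !iotaE => /(can_inj gK) [].
- by move=> l; exists (g (l, 0)); rewrite piE gK.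
- move=> x; rewrite piE; split=> [fx1|[h ->]]; last by rewrite iotaE gK.
  by exists (f x).2; rewrite iotaE -fx1 -surjective_pairing fK.
- have sumL2 : (\sum_(l : L) l) *+ 2 = 0.
    by rewrite mulr2n {2}(reindex_inj oppr_inj) /= sumrN subrr.
  (* The L-components of the elements of Gam add up to |H| times this sum. *)
  rewrite -(mulr2n_odd_eq0 sumL2 H_odd) -[RHS](raddf0 pi) -(sum_classG Gam_G).
  rewrite raddf_sum [RHS](reindex g) /=; last by apply: onW_bij; exists f.
  under [RHS]eq_bigr do rewrite piE gK.
  rewrite -(pair_bigA _ (fun l _ => l)) /= -sumrMnl.
  by apply: eq_bigr => l _; rewrite sumr_const.
- exact: id_complete_mapping.
Qed.
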